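(* $add(v^0) = add(v)$.
   Context: $[\omega]^\omega$ is the family of all infinite subsets of $\omega$. For $A \subseteq B \subseteq \omega$ with $B\setminus A$ infinite, the set $\langle A,B\rangle = \{X \in [\omega]^\omega : A \subseteq X \subseteq B\}$ is called a segment. A set $S \subseteq [\omega]^\omega$ is a $v$-set if for each segment $\langle A,B\rangle$ there is a segment $\langle C,D\rangle \subseteq \langle A,B\rangle$ with $\langle C,D\rangle \subseteq S$ or $\langle C,D\rangle \cap S = \emptyset$; it is a $v^0$-set if for each segment $\langle A,B\rangle$ there is a segment $\langle C,D\rangle \subseteq \langle A,B\rangle$ with $\langle C,D\rangle \cap S = \emptyset$. The family of all $v$-sets is a $\sigma$-field, denoted $(v)$; the family of all $v^0$-sets is a $\sigma$-ideal, denoted $(v^0)$. $add(v^0) = \min\{|\mathcal{F}| : \mathcal{F} \subseteq (v^0) \text{ and } \bigcup\mathcal{F} \notin (v^0)\}$ and $add(v) = \min\{|\mathcal{F}| : \mathcal{F} \subseteq (v) \text{ and } \bigcup\mathcal{F} \notin (v)\}$. *)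

(* Defs.v *)
From mathcomp Require Import all_boot all_classical.

Set Implicit Arguments.
Unset Strict Implicit.
Unset Printing Implicit Defensive.

Local Open Scope classical_set_scope.
Local Open Scope card_scope.

Definition infinite_sets : set (set nat) := [set X | infinite_set X].

Definition segment (A B : set nat) : set (set nat) :=
  [set X | [/\ infinite_sets X, A `<=` X & X `<=` B]].

Definition is_segment (I : set (set nat)) : Prop :=
  exists A B : set nat,
    [/\ A `<=` B, infinite_set (B `\` A) & I = segment A B].

Definition v_sets : set (set (set nat)) :=
  [set S | S `<=` infinite_sets /\
    forall I, is_segment I ->
      exists J, [/\ is_segment J, J `<=` I & J `<=` S \/ J `&` S = set0]].

Definition v0_sets : set (set (set nat)) :=
  [set S | S `<=` infinite_sets /\
    forall I, is_segment I ->
      exists J, [/\ is_segment J, J `<=` I & J `&` S = set0]].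

(* The cardinal number of [A] is encoded as the class of all sets (over the
   same type) equipotent to [A], so equality of cardinals is plain equality. *)
Definition cardinal (T : Type) (A : set T) : set (set T) := [set B | B #= A].

(* min {|F| : P F}: the union has at most one distinct nonempty term, since
   any two members of [P] of least size are equipotent; it is empty exactly
   when no member of [P] has least size, i.e. when the minimum does not exist. *)
Definition min_cardinal (T : Type) (P : set (set T)) : set (set T) :=
  \bigcup_(F in [set F | P F /\ forall G, P G -> F #<= G]) cardinal F.

Definition add (J : set (set (set nat))) : set (set (set (set nat))) :=
  min_cardinal [set F | F `<=` J /\ ~ J (\bigcup_(S in F) S)].

(* Main.v *)
(* Both additivities are reached from one another by intersecting the members
   of a family with a fixed set.  If the union of a family of v-sets is not a
   v-set, some segment I contains no subsegment inside or outside that union;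
   below I the v-sets of the family then avoid some subsegment of every segment,
   so their traces on I are v0-sets whose union is not v0.  Conversely, let the
   union of a family of v0-sets not be v0.  If it is a v-set it contains a
   segment; intersecting the family with a set that meets and misses every
   segment yields v0-sets whose union is not a v-set.  Such a set is obtained by
   choosing a representative of each class of sets modulo finite and taking the
   sets at even distance from their representative. *)
Require Import Defs.
From mathcomp Require Import all_boot finmap all_classical.

Set Implicit Arguments.
Unset Strict Implicit.
Unset Printing Implicit Defensive.

Local Open Scope classical_set_scope.
Local Open Scope card_scope.

(** * Least cardinals and their comparison *)

Section Cardinals.
Variable T : Type.
Implicit Types (P Q : set (set T)) (F G : set T).

(* Hoenig's argument: by Zorn, take a maximal set Y of choice functions on P
   any two of which differ at every member of P.  Evaluation embeds Y into every
   member of P, and by maximality it is onto one of them. *)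
Lemma ex_least_card P :
  P !=set0 -> exists F, P F /\ forall G, P G -> F #<= G.
Proof.
move=> [F0 PF0].
pose ok (Y : set (set T -> T)) :=
  (forall f F, Y f -> P F -> F (f F)) /\
  (forall f g F, Y f -> Y g -> P F -> f F = g F -> f = g).
have [Y [[Ymem Yinj] Ymax]] : exists Y, ok Y /\ forall Z, Y `<` Z -> ~ ok Z.
  apply: Zorn_bigcup => C Cok Ctot; split.
    by move=> f F [Y CY Yf]; exact: (Cok _ CY).1.
  move=> f g F [Y CY Yf] [Z CZ Zg].
  have [YZ|ZY] := Ctot _ _ CY CZ.
    by apply: (Cok _ CZ).2 => //; exact: YZ.
  by apply: (Cok _ CY).2 => //; exact: ZY.
have [F [PF Fsurj]] : exists F, P F /\ F `<=` [set f F | f in Y].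
  apply: contrapT => nsurj.
  have fresh F : P F -> exists x, F x /\ forall f, Y f -> f F <> x.
    move=> PF; apply: contrapT => nx; apply: nsurj; exists F; split=> // x Fx.
    apply: contrapT => nYx; apply: nx; exists x; split=> // f Yf fx.
    by apply: nYx; exists f.
  (* [x0] serves only as the value of [h] outside [P]. *)
  have [x0 _] := fresh _ PF0.
  have [h hP] : {h : set T -> T &
      forall F, P F -> F (h F) /\ forall f, Y f -> f F <> h F}.
    apply: (@choice _ _ (fun F x => P F -> F x /\ forall f, Y f -> f F <> x)).
    move=> F; have [/fresh[x xP]|nPF] := pselect (P F); first by exists x.
    by exists x0.
  apply: (Ymax (Y `|` [set h])).
    split; first exact: subsetUl.
    move=> /(_ h (or_intror erefl)) Yh.
    by have [_ /(_ _ Yh)] := hP _ PF0.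
  split; first by move=> f F [Yf|->] PF; [exact: (Ymem f F)|have [] := hP _ PF].
  move=> f g F [Yf|->] [Yg|->] PF fg //; first exact: (Yinj f g F).
    by have [_ /(_ _ Yf)] := hP _ PF.
  by have [_ /(_ _ Yg)] := hP _ PF; rewrite fg.
exists F; split=> // G PG.
apply: (@card_le_trans _ _ _ Y).
  apply: card_le_trans (card_image_le (fun f => f F) Y).
  exact: subset_card_le.
have evG : {in Y &, injective (fun f : set T -> T => f G)}.
  by move=> f g /set_mem Yf /set_mem Yg; exact: Yinj.
have /card_eqPle[_ Yle] := inj_card_eq evG.
apply: card_le_trans Yle _; apply: subset_card_le => _ [f Yf <-].
exact: (Ymem f G).
Qed.

Lemma min_cardinal_neq0 P : P !=set0 -> min_cardinal P !=set0.
Proof.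
by move=> /ex_least_card[F minF]; exists F, F => //; exact: card_eqxx.
Qed.

(** A least [F] in [P] lies below every member of [Q], in particular below the [G] of [Q] with
    [G #<= F]; by Cantor-Bernstein [F] and [G] are equipotent, and [G] is least in [Q]. *)
Lemma min_cardinal_sub P Q :
    (forall F, P F -> exists2 G, Q G & G #<= F) ->
    (forall G, Q G -> exists2 F, P F & F #<= G) ->
  min_cardinal P `<=` min_cardinal Q.
Proof.
move=> PQ QP B [F [PF minF] BF].
have [G QG GF] := PQ _ PF.
have leF H : Q H -> F #<= H.
  by move=> /QP[F' PF' F'H]; exact: card_le_trans (minF _ PF') F'H.
exists G; last first.
  by apply: card_eq_trans BF _; apply/card_eqPle; split=> //; exact: leF.
by split=> // H /leF; exact: card_le_trans.
Qed.

End Cardinals.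

(** * Segments and their subsegments *)

Section Segments.
Implicit Types (A B C D X : set nat) (I J : set (set nat)).

Lemma segmentP A B :
  A `<=` B -> infinite_set (B `\` A) -> is_segment (segment A B).
Proof. by exists A, B. Qed.

Lemma sub_segment A B C D :
  A `<=` C -> D `<=` B -> segment C D `<=` segment A B.
Proof.
move=> AC DB X [infX CX XD].
by split=> //; [exact: subset_trans CX|exact: subset_trans DB].
Qed.

Lemma sub_segment_add A B n : A `<=` B -> infinite_set (B `\` A) -> B n ->
  is_segment (segment (n |` A) B) /\ segment (n |` A) B `<=` segment A B.
Proof.
move=> AB infBA Bn; split; last by apply: sub_segment => //; exact: subsetUr.
apply: segmentP; first by move=> x [->|/AB].
rewrite setUC -setDDl; apply: infinite_setD => //; exact: finite_set1.
Qed.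

Lemma subset_setD1 A B n : A `<=` B -> ~ A n -> A `<=` B `\ n.
Proof.
by move=> AB nAn x Ax; split; [exact: AB|move=> xn; rewrite -xn in nAn].
Qed.

Lemma sub_segment_del A B n : A `<=` B -> infinite_set (B `\` A) -> ~ A n ->
  is_segment (segment A (B `\ n)) /\ segment A (B `\ n) `<=` segment A B.
Proof.
move=> AB infBA nAn; split; last by apply: sub_segment => // x [].
apply: segmentP; first exact: subset_setD1.
rewrite setDDl setUC -setDDl; apply: infinite_setD => //; exact: finite_set1.
Qed.

Lemma segment_top A B : infinite_set (B `\` A) -> A `<=` B -> segment A B B.
Proof. by move=> infBA AB; split=> //; apply: sub_infinite_set infBA => x []. Qed.

Lemma is_segment_neq0 I : is_segment I -> I !=set0.
Proof. by move=> [A [B [AB infBA ->]]]; exists B; exact: segment_top. Qed.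

Lemma is_segment_infinite I : is_segment I -> I `<=` infinite_sets.
Proof. by move=> [A [B [_ _ ->]]] X []. Qed.

(** Segments are themselves v-sets: unless [J] lies in [I], one point separates them, either deleted
    from the top of [J] though [I] requires it, or added to the bottom of [J] though [I] forbids
    it. *)
Lemma segment_split I J : is_segment I -> is_segment J ->
  exists K, [/\ is_segment K, K `<=` J & K `<=` I \/ K `&` I = set0].
Proof.
move=> [A [B [AB infBA ->]]] [C [D [CD infDC ->]]].
have [AC|/nonsubset[n [An nCn]]] := pselect (A `<=` C); last first.
  have [segK KJ] := sub_segment_del CD infDC nCn.
  exists (segment C (D `\ n)); split=> //; right.
  apply/seteqP; split=> // X [[_ _ XD] [_ AX _]].
  by have [_] := XD _ (AX _ An); apply.
have [DB|/nonsubset[n [Dn nBn]]] := pselect (D `<=` B); last first.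
  have [segK KJ] := sub_segment_add CD infDC Dn.
  exists (segment (n |` C) D); split=> //; right.
  apply/seteqP; split=> // X [[_ nX _] [_ _ XB]].
  by apply: nBn; apply: XB; apply: nX; left.
by exists (segment C D); split=> //; [exact: segmentP|left; exact: sub_segment].
Qed.

End Segments.

(** * Basic v-sets and v0-sets *)

Section VSets.
Implicit Types (S : set (set nat)) (F G : set (set (set nat))).

Lemma v0_sets_sub : v0_sets `<=` v_sets.
Proof.
move=> S [infS v0S]; split=> // I /v0S[J [segJ JI JS]].
by exists J; split=> //; right.
Qed.

Lemma v0_sets_subset S S' : S `<=` S' -> v0_sets S' -> v0_sets S.
Proof.
move=> SS' [infS' v0S']; split; first exact: subset_trans infS'.
move=> I /v0S'[J [segJ JI JS']]; exists J; split=> //.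
by apply: subsetI_eq0 JS'.
Qed.

Lemma bigcup_infinite F :
  F `<=` v_sets -> \bigcup_(S in F) S `<=` infinite_sets.
Proof. by move=> Fv X [S /Fv[infS _] /infS]. Qed.

(** A point that the segment leaves undecided is decided against [X]. *)
Lemma v0_sets1 X : infinite_set X -> v0_sets [set X].
Proof.
move=> infX; split=> [_ ->//|I [A [B [AB infBA ->]]]].
have [n [Bn nAn]] := infinite_setN0 infBA.
have [Xn|nXn] := pselect (X n).
  have [segJ JI] := sub_segment_del AB infBA nAn.
  exists (segment A (B `\ n)); split=> //.
  apply/seteqP; split=> // Y [[_ _ YB] YX].
  by have [|_] := YB n; [rewrite YX|apply].
have [segJ JI] := sub_segment_add AB infBA Bn.
exists (segment (n |` A) B); split=> //.
apply/seteqP; split=> // Y [[_ AY _] YX].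
by apply: nXn; rewrite -YX; apply: AY; left.
Qed.

Lemma not_v0_infinite_sets : ~ v0_sets infinite_sets.
Proof.
move=> [_ /(_ (segment set0 setT))[]].
  by apply: segmentP => //; rewrite setD0; exact: infinite_nat.
move=> J [segJ _ J0]; have [X JX] := is_segment_neq0 segJ.
by suff: set0 X by []; rewrite -J0; split=> //; exact: is_segment_infinite JX.
Qed.

(** Ensures that the minimum exists: the singletons cover all infinite sets, and no segment is
    empty. *)
Lemma ex_non_additive_v0 :
  [set F | F `<=` v0_sets /\ ~ v0_sets (\bigcup_(S in F) S)] !=set0.
Proof.
exists [set [set X] | X in infinite_sets]; split.
  by move=> _ [X infX <-]; exact: v0_sets1.
rewrite bigcup_image (bigcup_imset1 _ id) image_id.
exact: not_v0_infinite_sets.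
Qed.

(** * A set that meets and misses every segment *)

Definition eq_mod_fin (X Y : set nat) := finite_set (X `+` Y).

Lemma eq_mod_fin_sym X Y : eq_mod_fin X Y -> eq_mod_fin Y X.
Proof. by rewrite /eq_mod_fin setYC. Qed.

Lemma eq_mod_fin_trans X Y Z :
  eq_mod_fin X Y -> eq_mod_fin Y Z -> eq_mod_fin X Z.
Proof.
move=> fXY fYZ; have : finite_set ((X `+` Y) `|` (Y `+` Z)) by rewrite finite_setU.
apply: sub_finite_set => x; rewrite /setY /=.
by have [] := pselect (Y x); tauto.
Qed.

Definition mod_fin_repr (X : set nat) := xget set0 (eq_mod_fin X).

Lemma mod_fin_reprP X : eq_mod_fin X (mod_fin_repr X).
Proof. by apply: xgetPex; exists X; rewrite /eq_mod_fin setYK. Qed.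

Lemma eq_mod_fin_repr X Y :
  eq_mod_fin X Y -> mod_fin_repr X = mod_fin_repr Y.
Proof.
move=> XY; congr xget; apply/funext => Z; apply/propext.
split; apply: eq_mod_fin_trans => //; exact: eq_mod_fin_sym.
Qed.

(** The complement consists of the sets at even distance; either parity would do. Finite sets may
    belong to it, but it is only ever intersected with v0-sets. *)
Definition odd_set : set (set nat) :=
  [set X | odd #|` fset_set (X `+` mod_fin_repr X)|].

Lemma odd_fset_setU1 (D : set nat) n : finite_set D -> ~ D n ->
  odd #|` fset_set (n |` D)| = ~~ odd #|` fset_set D|.
Proof.
move=> finD nDn; rewrite fset_setU1// cardfsU1 in_fset_set//.
by rewrite memNset.
Qed.

(** Both sets share a representative [r], and their symmetric differences with [r] differ exactly by
    [n]; whether [n] is in [r] decides which is larger. *)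
Lemma odd_setU1 X n : ~ X n -> odd_set (n |` X) <-> ~ odd_set X.
Proof.
move=> nXn; have reprE : mod_fin_repr (n |` X) = mod_fin_repr X.
  apply: eq_mod_fin_repr; apply: sub_finite_set (finite_set1 n) => x.
  by rewrite /setY /=; tauto.
rewrite /odd_set /= reprE.
have finX := mod_fin_reprP X; have finnX := mod_fin_reprP (n |` X).
rewrite /eq_mod_fin reprE in finnX.
move: finX finnX; rewrite /eq_mod_fin; set r := mod_fin_repr X => finX finnX.
have [rn|nrn] := pselect (r n).
  have -> : X `+` r = n |` ((n |` X) `+` r).
    by apply/seteqP; split=> x; rewrite /setY /=;
      (have [->|] := pselect (x = n); tauto).
  rewrite odd_fset_setU1//; last by rewrite /setY /=; tauto.
  by case: odd; split.
have -> : (n |` X) `+` r = n |` (X `+` r).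
  by apply/seteqP; split=> x; rewrite /setY /=;
    (have [->|] := pselect (x = n); tauto).
rewrite odd_fset_setU1//; last by rewrite /setY /=; tauto.
by case: odd; split.
Qed.

(** For [n] in the gap, [B] and [B] without [n] both lie in the segment and have opposite
    parities. *)
Lemma segment_meets_odd_set I : is_segment I ->
  I `&` odd_set !=set0 /\ I `&` ~` odd_set !=set0.
Proof.
move=> [A [B [AB infBA ->]]].
have [n [Bn nAn]] := infinite_setN0 infBA.
have IB := segment_top infBA AB.
have IBn : segment A B (B `\ n).
  split; [|exact: subset_setD1|by move=> x []].
  by apply: infinite_setD; [case: IB|exact: finite_set1].
have : odd_set B <-> ~ odd_set (B `\ n).
  have {1}-> : B = n |` (B `\ n).
    apply/seteqP; split=> x /=; last by move=> [->|[]].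
    by have [] := pselect (x = n); tauto.
  by apply: odd_setU1 => -[_]; apply.
have [oB|noB] := pselect (odd_set B) => oddB.
  by split; [exists B|exists (B `\ n); split=> //; apply/oddB].
split; [|by exists B].
by exists (B `\ n); split=> //; apply: contrapT => /oddB.
Qed.

(** * Transfer of non-additive families *)

Lemma non_additive_v0_of_v F :
    F `<=` v_sets -> ~ v_sets (\bigcup_(S in F) S) ->
  exists2 G, G `<=` v0_sets /\ ~ v0_sets (\bigcup_(S in G) S) & G #<= F.
Proof.
move=> Fv nvF.
have [I [segI Ihom]] : exists I, is_segment I /\ forall J, is_segment J ->
    J `<=` I -> ~ (J `<=` \bigcup_(S in F) S \/ J `&` \bigcup_(S in F) S = set0).
  apply: contrapT => nI; apply: nvF; split; first exact: bigcup_infinite.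
  move=> I segI; apply: contrapT => nJ; apply: nI; exists I; split=> //.
  by move=> J segJ JI JF; apply: nJ; exists J.
exists [set S `&` I | S in F]; last exact: card_image_le.
split.
  move=> _ [S FS <-]; have [infS vS] := Fv _ FS.
  split=> [X [/infS]//|J segJ].
  (* Off [I] the trace is empty; below [I] no segment lies inside [S], so the v-set property yields
     one that misses [S]. *)
  have [K [segK KJ [KI|KI]]] := segment_split segI segJ; last first.
    by exists K; split=> //; rewrite setIC -setIA [I `&` _]setIC KI setI0.
  have [L [segL LK [LS|LS]]] := vS _ segK; last first.
    by exists L; split=> //; [exact: subset_trans KJ|rewrite setIA LS set0I].
  have LI := subset_trans LK KI.
  by case: (Ihom _ segL LI); left=> X LX; exists S => //; exact: LS.
move=> [_ /(_ _ segI)[J [segJ JI]]].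
rewrite bigcup_image -setI_bigcupl [_ `&` I]setIC setIA (setIidl JI) => J0.
by apply: (Ihom _ segJ JI); right.
Qed.

Lemma non_additive_v_of_v0 F :
    F `<=` v0_sets -> ~ v0_sets (\bigcup_(S in F) S) ->
  exists2 G, G `<=` v_sets /\ ~ v_sets (\bigcup_(S in G) S) & G #<= F.
Proof.
move=> Fv0 nv0F.
have Fv := subset_trans Fv0 v0_sets_sub.
have [vF|nvF] := pselect (v_sets (\bigcup_(S in F) S)); last first.
  by exists F => //; exact: card_lexx.
have [J [segJ JF]] : exists J, is_segment J /\ J `<=` \bigcup_(S in F) S.
  apply: contrapT => nJ; apply: nv0F; split; first exact: vF.1.
  move=> I /vF.2[J [segJ JI [JF|JF]]]; last by exists J.
  by case: nJ; exists J.
exists [set S `&` odd_set | S in F]; last exact: card_image_le.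
split.
  move=> _ [S /Fv0 v0S <-]; apply: v0_sets_sub.
  by apply: v0_sets_subset v0S => X [].
move=> [_ /(_ _ segJ)[K [segK KJ]]].
rewrite bigcup_image -setI_bigcupl.
(* [Y] keeps [K] from lying inside the new union; [X], covered by [F] because [K] is below [J],
   keeps [K] from missing it. *)
have [[X [KX oX]] [Y [KY noY]]] := segment_meets_odd_set segK.
case=> [/(_ _ KY)[_]//|K0].
suff : set0 X by [].
by rewrite -K0; split=> //; split=> //; apply/JF/KJ.
Qed.

End VSets.

Theorem theorem16 : add v0_sets !=set0 /\ add v0_sets = add v_sets.
Proof.
split; first exact/min_cardinal_neq0/ex_non_additive_v0.
apply/seteqP; split; apply: min_cardinal_sub => F [].
- exact: non_additive_v_of_v0.
- exact: non_additive_v0_of_v.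
- exact: non_additive_v0_of_v.
- exact: non_additive_v_of_v0.
Qed.
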